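(* Let $p\ge 1$ be an integer. The following assertions are equivalent: (a) for every integer $n\ge p$, $s_{n,p}$ is an $\mathbb{I}$-hyperbolic polynomial; (b) $s_{p,p}$ is an $\mathbb{I}$-hyperbolic polynomial; (c) $\pi_p(\mu,\lambda)\in\mathbb{R}[X]$ is real-rooted for all $\lambda,\mu\in\mathbb{R}^p$. Moreover, for all $\lambda,\mu\in\mathbb{R}^p$, $$\pi_p(\mu,\lambda)=\sum_{l=0}^p\left(\sum_{i=0}^{p-l}\frac{(p-i)!\,(l+i)!}{p!\,l!}\,\sigma_{p-l-i}(\mu)\,\sigma_i(\lambda)\right)(2X)^l.$$
   Context: $\sigma_k$ denotes the $k$-th elementary symmetric polynomial in the coordinates of its vector argument ($\sigma_0=1$). For $n\ge p$, the semi-symmetric polynomial $s_{n,p}$ is the polynomial in $n+p$ variables $s_{n,p}(x,\lambda)=\sum_{k=0}^p \frac{\sigma_k(x)\,\sigma_{p-k}(\lambda)}{\binom{n}{k}}$ for $x\in\mathbb{R}^n$, $\lambda\in\mathbb{R}^p$. $\mathbb{I}=(1,\ldots,1)$, in whatever dimension is appropriate. For $\mu,\lambda\in\mathbb{R}^p$, $\pi_p(\mu,\lambda)=s_{p,p}(\mu+X\cdot\mathbb{I},\lambda+X\cdot\mathbb{I})\in\mathbb{R}[X]$. A polynomial $P\in\mathbb{R}[X_1,\ldots,X_N]$ is $v$-hyperbolic, for $v\in\mathbb{R}^N$, if $P$ is homogeneous, $P(v)>0$, and for every $x\in\mathbb{R}^N$ the one-variable polynomial $P(x+X\cdot v)\in\mathbb{R}[X]$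 is real-rooted. A real polynomial is real-rooted if all its complex roots are real. *)

(* Defs.v *)
From HB Require Import structures.
From mathcomp Require Import all_boot all_order all_algebra.
From mathcomp Require Import reals complex mpoly.

Set Implicit Arguments.
Unset Strict Implicit.
Unset Printing Implicit Defensive.

Import Order.TTheory GRing.Theory Num.Theory.
Local Open Scope ring_scope.

Definition real_rooted (R : realType) (q : {poly R}) : Prop :=
  forall z : R[i], root (map_poly (real_complex R) q) z -> complex.Im z = 0.

(* The univariate polynomial P(x + X v). *)
Definition line_poly (R : realType) (N : nat) (P : {mpoly R[N]})
    (x v : 'rV[R]_N) : {poly R} :=
  mmap polyC (fun i => (x 0 i)%:P + 'X * (v 0 i)%:P) P.

Definition hyperbolic (R : realType) (N : nat) (v : 'rV[R]_N)
    (P : {mpoly R[N]}) : Prop :=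
  [/\ exists d : nat, P \is d.-homog,
      0 < P.@[v 0]
    & forall x : 'rV[R]_N, real_rooted (line_poly P x v)].

Definition sigma (R : realType) (n k : nat) (x : 'rV[R]_n) : R :=
  (mesym n R k).@[x 0].

(* The variables x are the first n of the n + p variables, and the variables
   lambda are the last p. *)
Definition semisym (R : realType) (n p : nat) : {mpoly R[n + p]} :=
  \sum_(k < p.+1) ('C(n, k)%:R)^-1 *:
    (comp_mpoly [tuple 'X_(lshift p i) | i < n] (mesym n R k) *
     comp_mpoly [tuple 'X_(rshift n j) | j < p] (mesym p R (p - k))).

(* (mu + X I, lambda + X I) is the line through (mu, lambda) directed by I. *)
Definition pi_poly (R : realType) (p : nat) (mu lambda : 'rV[R]_p) : {poly R} :=
  line_poly (semisym R p p) (row_mx mu lambda) (const_mx 1).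

(* Main.v *)
(* With q_x = prod_i (X + x_i), the Taylor expansion of q_x shows that
   sigma_k(x + X I) = q_x^(n-k) / (n-k)!, so that
     s_{n,p}(x + X I, l + X I) = 1/n! sum_{k <= p} q_x^(n-k) q_l^(k).
   The right-hand side depends on x only through q_x^(n-p), whose roots are
   real; up to scaling it is q_y for some y in R^p, which reduces s_{n,p} to
   s_{p,p}. Expanding the right-hand side for n = p bilinearly in the monomials
   of q_x and q_l gives the explicit formula. *)
Require Import Defs.
From HB Require Import structures.
From mathcomp Require Import all_boot all_order all_algebra.
From mathcomp Require Import reals complex mpoly cauchyreals.
From mathcomp Require Import ring zify.

Set Implicit Arguments.
Unset Strict Implicit.
Unset Printing Implicit Defensive.

Import Order.TTheory GRing.Theory Num.Theory.
Local Open Scope ring_scope.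

(** * Elementary symmetric sums over a ring *)

(** Valued in any ring, so that it also applies to the polynomials ['X + x_i]. *)
Definition elsym (A : nzRingType) (n : nat) (c : 'I_n -> A) (k : nat) : A :=
  \sum_(h : {set 'I_n} | #|h| == k) \prod_(i in h) c i.

Lemma mmap_mesym (R : nzRingType) (S : comNzRingType) (n k : nat)
    (f : {rmorphism R -> S}) (h : 'I_n -> S) :
  mmap f h (mesym n R k) = elsym h k.
Proof.
rewrite /mesym rmorph_sum; apply: eq_bigr => /= s _.
by rewrite rmorph_prod; apply: eq_bigr => i _; rewrite /= mmapX mmap1U.
Qed.

Lemma mmap_comp_mpoly (R S : comNzRingType) (m n : nat)
    (f : {rmorphism R -> S}) (h : 'I_n -> S) (t : m.-tuple {mpoly R[n]})
    (P : {mpoly R[m]}) :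
  mmap f h (comp_mpoly t P) = mmap f (fun i => mmap f h (tnth t i)) P.
Proof.
rewrite comp_mpolyEX /mmap -/(mmap f h _) rmorph_sum /=.
apply: eq_bigr => a _; rewrite mmapZ comp_mpolyX rmorph_prod; congr (_ * _).
by apply: eq_bigr => i _; rewrite rmorphXn.
Qed.

(** Expanding the product chooses the subset [J] of factors that contribute [c i]; these subsets are
    then grouped by cardinality. *)
Lemma prod_XD_elsym (A : comNzRingType) (n : nat) (c : 'I_n -> A) :
  \prod_(i < n) ('X + (c i)%:P) = \sum_(k < n.+1) elsym c k *: 'X^(n - k).
Proof.
under eq_bigr do rewrite addrC.
rewrite bigA_distr /=.
pose F (J : {set 'I_n}) := (\prod_(i in J) c i) *: 'X^(n - #|J|).
rewrite (eq_bigr F) => [|J _]; last first.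
  rewrite (bigID (mem J)) /= /F -mul_polyC rmorph_prod /=.
  congr (_ * _); first by apply: eq_bigr => i ->.
  rewrite (eq_bigr (fun=> 'X)) => [|i /negbTE -> //].
  under eq_bigl do rewrite -in_setC.
  by rewrite prodr_const; congr (_ ^+ _); rewrite cardsCs setCK card_ord.
rewrite (partition_big (fun J : {set 'I_n} => inord #|J| : 'I_n.+1) xpredT) //=.
have cardI (J : {set 'I_n}) : (#|J| < n.+1)%N.
  by rewrite ltnS -[n in X in (_ <= X)%N]card_ord max_card.
apply: eq_bigr => k _; rewrite scaler_suml.
rewrite (eq_bigl (fun J : {set 'I_n} => #|J| == k)) => [|J].
  by apply: eq_bigr => J /eqP <-.
by rewrite -val_eqE /= inordK.
Qed.

(** * The polynomials q_x and their Taylor expansion *)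

Definition shifts (A : comNzRingType) (n : nat) (x : 'rV[A]_n) : {poly A} :=
  \prod_(i < n) ('X + (x 0 i)%:P).

Lemma shifts_elsym (A : comNzRingType) (n : nat) (x : 'rV[A]_n) :
  shifts x = \sum_(k < n.+1) elsym (x 0) k *: 'X^(n - k).
Proof. exact: prod_XD_elsym. Qed.

Lemma shifts_XsubC (A : comNzRingType) (n : nat) (x : 'rV[A]_n) :
  shifts x = \prod_(a <- [seq - x 0 i | i <- enum 'I_n]) ('X - a%:P).
Proof.
rewrite /shifts big_map big_enum; apply: eq_bigr => i _.
by rewrite polyCN opprK.
Qed.

Lemma shifts_monic (A : comNzRingType) (n : nat) (x : 'rV[A]_n) :
  shifts x \is monic.
Proof. by rewrite shifts_XsubC monic_prod_XsubC. Qed.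

Lemma size_shifts (A : comNzRingType) (n : nat) (x : 'rV[A]_n) :
  size (shifts x) = n.+1.
Proof. by rewrite shifts_XsubC size_prod_XsubC size_map size_enum_ord. Qed.

Lemma coef_sum_revX (A : nzRingType) (n : nat) (a : nat -> A) (m : nat) :
  (m <= n)%N -> (\sum_(k < n.+1) a k *: 'X^(n - k))`_m = a (n - m)%N.
Proof.
move=> le_mn; rewrite coef_sum.
have lt_m : (n - m < n.+1)%N by rewrite ltnS leq_subr.
rewrite (bigD1 (Ordinal lt_m)) //= coefZ coefXn subKn // eqxx mulr1.
rewrite big1 ?addr0 // => k neq_k; rewrite coefZ coefXn.
case: eqP => [mE|]; last by rewrite mulr0.
by case/eqP: neq_k; apply: val_inj; rewrite /= mE subKn // -ltnS.
Qed.

(* Taylor expansion at 'X: both sides are the coefficient of Y^(n - k) in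
   the product of the (Y + X + x_i). *)
Lemma elsym_nderivn (A : comNzRingType) (n k : nat) (x : 'rV[A]_n) :
  (k <= n)%N -> elsym (fun i => 'X + (x 0 i)%:P) k = (shifts x)^`N(n - k).
Proof.
(* The outer variable of [{poly {poly A}}] is Y and the inner one is X; [f] embeds [A] as constants
   for both. *)
move=> le_kn; pose f : {rmorphism A -> {poly {poly A}}} := polyC \o polyC.
pose q := shifts x.
have eval_f (P : {poly A}) : (map_poly f P).['X%:P] = P%:P.
  rewrite map_poly_comp horner_map /=; congr (_ %:P).
  by rewrite -/(P \Po 'X) comp_polyXr.
have: (map_poly f q).['X%:P + 'X] =
      \sum_(j < n.+1) elsym (fun i => 'X + (x 0 i)%:P) j *: 'X^(n - j).
  rewrite -prod_XD_elsym /q /shifts rmorph_prod horner_prod.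
  apply: eq_bigr => i _; rewrite rmorphD /= map_polyX map_polyC /= !hornerE.
  by rewrite addrAC addrC polyCD.
rewrite (@nderiv_taylor_wide _ n.+1); last 2 first.
- exact: mulrC.
- by rewrite (leq_trans (size_poly _ _)) // size_shifts.
move=> /(congr1 (fun P : {poly {poly A}} => P`_(n - k))).
rewrite coef_sum_revX ?leq_subr // subKn // => <-.
rewrite coef_sum.
have lt_m : (n - k < n.+1)%N by rewrite ltnS leq_subr.
rewrite (bigD1 (Ordinal lt_m)) //= nderivn_map eval_f.
rewrite coefCM coefXn eqxx mulr1 big1 ?addr0 // => j neq_j.
rewrite nderivn_map eval_f coefCM coefXn.
case: eqP => [mE|]; last by rewrite mulr0.
by case/eqP: neq_j; apply: val_inj.
Qed.

(** Taylor expansion gives the factors q_x^(n-k)/(n-k)! and q_l^(k)/k!; dividing by ['C(n, k)] turns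
    the two factorials into n!. *)
Lemma line_poly_semisym (R : realType) (n p : nat) (x : 'rV[R]_n)
    (l : 'rV[R]_p) : (p <= n)%N ->
  line_poly (semisym R n p) (row_mx x l) (const_mx 1) =
  (n`!%:R)^-1 *: \sum_(k < p.+1) (shifts x)^`(n - k) * (shifts l)^`(k).
Proof.
move=> le_pn; rewrite /line_poly /semisym.
set f := polyC; set h := fun i => _.
rewrite raddf_sum scaler_sumr; apply: eq_bigr => k _ /=.
have le_kp : (k <= p)%N by rewrite -ltnS.
have le_kn := leq_trans le_kp le_pn.
rewrite mmapZ mul_polyC rmorphM /= !mmap_comp_mpoly !mmap_mesym.
have hl : (fun i => mmap f h (tnth [tuple 'X_(lshift p i) | i < n] i)) =1
    (fun i => 'X + (x 0 i)%:P).
  by move=> i; rewrite tnth_mktuple mmapX mmap1U /h row_mxEl mxE mulr1 addrC.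
have hr : (fun i => mmap f h (tnth [tuple 'X_(rshift n i) | i < p] i)) =1
    (fun i => 'X + (l 0 i)%:P).
  by move=> i; rewrite tnth_mktuple mmapX mmap1U /h row_mxEr mxE mulr1 addrC.
have eq_elsym m (c d : 'I_m -> {poly R}) j : c =1 d -> elsym c j = elsym d j.
  by move=> cd; apply: eq_bigr => J _; apply: eq_bigr => i _; rewrite cd.
rewrite (eq_elsym _ _ _ _ hl) (eq_elsym _ _ _ _ hr).
rewrite !elsym_nderivn ?leq_subr // subKn // !nderivn_def.
rewrite mulrnAl mulrnAr -!scaler_nat !scalerA.
congr (_ *: _); rewrite -(bin_fact le_kn) !natrM.
by field; rewrite !pnatr_eq0 -!lt0n bin_gt0 le_kn !fact_gt0.
Qed.


(** * Homogeneity and positivity at the all-ones vector *)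

Lemma dhomog_prod_finset (R : comNzRingType) (n : nat) (I : finType) (h : {set I})
    (F : I -> {mpoly R[n]}) :
  (forall i, F i \is 1.-homog) -> \prod_(i in h) F i \is #|h|.-homog.
Proof.
move=> homF; rewrite cardE -big_enum /=.
elim: (enum h) => [|i s IHs] /=; first by rewrite big_nil dhomog1.
by rewrite big_cons -add1n dhomogM.
Qed.

Lemma dhomog_comp_mesym (R : comNzRingType) (m n k : nat)
    (t : m.-tuple {mpoly R[n]}) :
  (forall i, tnth t i \is 1.-homog) ->
  comp_mpoly t (mesym m R k) \is k.-homog.
Proof.
move=> homt; rewrite /comp_mpoly mmap_mesym; apply: rpred_sum => h /eqP <-.
exact: dhomog_prod_finset.
Qed.

Lemma semisym_homog (R : realType) (n p : nat) : semisym R n p \is p.-homog.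
Proof.
apply: rpred_sum => k _; apply: rpredZ.
have homX (m : nat) (i : 'I_m -> 'I_(n + p)) j :
    tnth [tuple 'X_(i j) | j < m] j \is [in R[n + p], 1.-homog].
  by rewrite tnth_mktuple dhomogX /= mdeg1.
have := dhomogM (dhomog_comp_mesym k (homX _ (lshift p)))
                (dhomog_comp_mesym (p - k) (homX _ (@rshift n p))).
by rewrite subnKC // -ltnS.
Qed.

Lemma elsym_const1 (A : nzRingType) (n k : nat) :
  elsym (fun _ : 'I_n => 1 : A) k = 'C(n, k)%:R.
Proof.
rewrite /elsym; under eq_bigr do rewrite big1 //.
by rewrite sumr_const -cardsE card_draws card_ord.
Qed.

Lemma semisym_pos (R : realType) (n p : nat) :
  0 < (semisym R n p).@[(const_mx 1 : 'rV[R]_(n + p)) 0].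
Proof.
have comp_one m k (t : m.-tuple {mpoly R[n + p]}) :
    (forall i, exists j, tnth t i = 'X_j) ->
    (comp_mpoly t (mesym m R k)).@[(const_mx 1 : 'rV[R]_(n + p)) 0] =
    'C(m, k)%:R.
  move=> tX; rewrite comp_mpoly_meval /meval mmap_mesym -elsym_const1.
  apply: eq_bigr => h _; apply: eq_bigr => i _.
  by have [j ->] := tX i; rewrite mmapX mmap1U mxE.
(* The two factors ['C(n, k)] are not cancelled, since they vanish for k > n. It suffices that all
   terms are nonnegative and that the term k = 0 equals 1. *)
rewrite /semisym raddf_sum /= (eq_bigr (fun k : 'I_p.+1 =>
    'C(n, k)%:R^-1 * ('C(n, k)%:R * 'C(p, p - k)%:R))) => [|k _].
  rewrite (bigD1 ord0) //= bin0 !mul1r invr1 mul1r subn0 binn.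
  rewrite ltr_pwDl // sumr_ge0 // => k _.
  by rewrite !mulr_ge0 ?invr_ge0 ?ler0n.
rewrite mevalZ rmorphM /= !comp_one // => i.
  by exists (rshift n i); rewrite tnth_mktuple.
by exists (lshift p i); rewrite tnth_mktuple.
Qed.

(** * Real-rootedness and differentiation *)

(** Over [R[i]] the polynomial splits; its roots equal their real parts, so the factorization
    descends to [R]. *)
Lemma real_rooted_splits (R : realType) (q : {poly R}) :
  real_rooted q ->
  exists s : seq R, q = lead_coef q *: \prod_(a <- s) ('X - a%:P).
Proof.
move=> rr_q; have [->|nz_q] := eqVneq q 0.
  by exists [::]; rewrite lead_coef0 scale0r.
have [r qE] := closed_field_poly_normal (map_poly (real_complex R) q).
exists [seq complex.Re z | z <- r].
apply: (map_poly_inj (real_complex R)); rewrite {1}qE /=.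
rewrite map_polyZ /= lead_coef_map big_map rmorph_prod /=; congr (_ *: _).
apply: eq_big_seq => z r_z; rewrite rmorphB /= map_polyX map_polyC /=.
have: complex.Im z = 0.
  apply: rr_q; rewrite qE rootZ ?root_prod_XsubC //.
  by rewrite lead_coef_map fmorph_eq0 lead_coef_eq0.
by case: z {r_z} => a b /= ->.
Qed.

(** The logarithmic derivative, used below for the Gauss-Lucas argument. *)
Lemma deriv_prod_XsubC (F : fieldType) (s : seq F) (z : F) : z \notin s ->
  (\prod_(a <- s) ('X - a%:P))^`().[z] =
  (\prod_(a <- s) ('X - a%:P)).[z] * \sum_(a <- s) (z - a)^-1.
Proof.
elim: s => [|a s IHs]; first by rewrite !big_nil derivC horner0 mulr0.
rewrite inE negb_or => /andP[za /IHs dE].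
rewrite !big_cons derivM derivXsubC mul1r !hornerE dE.
have: z - a != 0 by rewrite subr_eq0.
by move=> ?; field.
Qed.

(* Gauss-Lucas on the real line: off the real axis, all the terms of the
   logarithmic derivative of q have imaginary part of the sign of - Im z. *)
Lemma real_rooted_deriv (R : realType) (q : {poly R}) :
  (1 < size q)%N -> real_rooted q -> real_rooted q^`().
Proof.
move=> q_gt1 /real_rooted_splits[s qE] z rz.
have nz_q : lead_coef q != 0.
  by rewrite lead_coef_eq0 -size_poly_gt0 (ltn_trans _ q_gt1).
(* A nonempty list of roots is what makes the final sum strictly positive. *)
have s_gt0 : (0 < size s)%N.
  by move: q_gt1; rewrite qE size_scale // size_prod_XsubC.
apply/eqP; apply: contraT => nz_z.
pose t := [seq (real_complex R) a | a <- s].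
have t_z : z \notin t.
  by apply: contra nz_z => /mapP[a _ ->] /=.
have := rz; rewrite qE derivZ map_polyZ /= rootZ ?fmorph_eq0 //.
rewrite -deriv_map map_prod_XsubC.
rewrite -(big_map (real_complex R) xpredT (fun a => 'X - a%:P)) -/t.
rewrite /root deriv_prod_XsubC // mulf_eq0 -/(root _ z) root_prod_XsubC.
rewrite (negbTE t_z) /= big_map => /eqP /(congr1 (@complex.Im R)).
have ImD (x y : R[i]) : complex.Im (x + y) = complex.Im x + complex.Im y.
  by case: x y => [? ?] [].
have Im_term a : complex.Im (z - (real_complex R) a)^-1 =
    - complex.Im z / ((complex.Re z - a) ^+ 2 + complex.Im z ^+ 2).
  by case: (z) => x y /=; rewrite !subr0 mulNr.
have Im_sum (r : seq R) : complex.Im (\sum_(a <- r) (z - (real_complex R) a)^-1) =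
  - complex.Im z * \sum_(a <- r) ((complex.Re z - a) ^+ 2 + complex.Im z ^+ 2)^-1.
  elim: r => [|a r IHr]; first by rewrite !big_nil mulr0.
  by rewrite !big_cons ImD IHr Im_term mulrDr.
rewrite Im_sum /= => /eqP; rewrite mulf_eq0 oppr_eq0 (negbTE nz_z) /=.
have term_gt0 a : 0 < ((complex.Re z - a) ^+ 2 + complex.Im z ^+ 2)^-1.
  by rewrite invr_gt0 ltr_wpDl ?sqr_ge0 // exprn_even_gt0 //= nz_z.
case: (s) s_gt0 => // a r _; rewrite big_cons gt_eqF //.
by rewrite ltr_pwDl // sumr_ge0 // => b _; apply: ltW.
Qed.

(** The bound on [m] keeps the derivative nonzero: every complex number is a root of 0, which is
    thus not real-rooted. *)
Lemma real_rooted_derivn (R : realType) (q : {poly R}) (m : nat) :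
  (m < size q)%N -> real_rooted q -> real_rooted q^`(m).
Proof.
move=> + rr_q; elim: m => [|m IHm] lt_mq; first by rewrite derivn0.
rewrite derivnS; apply: real_rooted_deriv; last exact/IHm/ltnW.
by rewrite size_derivn ltn_subRL addn1.
Qed.

Lemma real_rootedZ (R : realType) (c : R) (q : {poly R}) : c != 0 ->
  real_rooted (c *: q) <-> real_rooted q.
Proof.
move=> nz_c; split=> rr z.
  by move=> rz; apply: rr; rewrite map_polyZ /= rootZ ?fmorph_eq0.
by rewrite map_polyZ /= rootZ ?fmorph_eq0 //; apply: rr.
Qed.

(** * The explicit formula for pi_p *)

(** With l = a + b - p, the k-th term is a! b! ['C(l, b - k)], and the binomials add up to 2^l. This
    is the source of the 2 in (2X)^l. *)
Lemma sum_ffact (p a b : nat) : (a <= p)%N -> (b <= p)%N -> (p <= a + b)%N ->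
  ((a + b - p)`! * \sum_(k < p.+1) a ^_ (p - k) * b ^_ k =
   a`! * b`! * 2 ^ (a + b - p))%N.
Proof.
move=> le_ap le_bp le_pab; set l := (a + b - p)%N.
have le_lb : (l <= b)%N by rewrite /l; lia.
(* The test [k <= b] is needed because truncated subtraction would give ['C(l, 0)], that is 1, for k
   > b. *)
have term k : (k <= p)%N -> (l`! * (a ^_ (p - k) * b ^_ k) =
   a`! * b`! * (if (k <= b)%N then 'C(l, b - k) else 0))%N.
  move=> le_kp; case: leqP => [le_kb|gt_kb]; last first.
    by rewrite (ffact_small gt_kb) !muln0.
  have [le_bkl|gt_bkl] := leqP (b - k) l; last first.
    rewrite bin_small // (ffact_small (_ : a < p - k)%N) ?muln0 //.
    by move: gt_bkl le_pab; rewrite /l; lia.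
  have le_pka : (p - k <= a)%N by move: le_bkl le_pab; rewrite /l; lia.
  have lbk : (l - (b - k) = a - (p - k))%N.
    by move: le_bkl le_pab; rewrite /l; lia.
  rewrite -(ffact_fact le_pka) -(ffact_fact le_kb) -(bin_fact le_bkl) lbk.
  by ring.
rewrite big_distrr /= (eq_bigr _ (fun (k : 'I_p.+1) _ => term k (ltn_ord k))).
rewrite -big_distrr /=; congr (_ * _)%N.
(* Drop the indices k > b, substitute b - k for k, then drop the indices beyond l, which is at most
   b. *)
rewrite -(big_mkord xpredT (fun k => if (k <= b)%N then 'C(l, b - k) else 0)%N).
rewrite (big_cat_nat (n := b.+1)) //= [X in (_ + X)%N]big_nat.
rewrite [X in (_ + X)%N]big1 ?addn0 => [|k]; last first.
  by case/andP=> lt_bk _; rewrite leqNgt lt_bk.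
rewrite big_nat_rev /= add0n.
rewrite (eq_big_nat _ _ (F2 := fun k => 'C(l, k))) => [|k /andP[_ lt_kb]];
  last by rewrite subSS leq_subr subKn.
rewrite (big_cat_nat (n := l.+1)) //=.
rewrite [X in (_ + X)%N]big_nat [X in (_ + X)%N]big1 ?addn0 => [|k]; last first.
  by case/andP=> lt_lk _; rewrite bin_small.
rewrite big_mkord -(addn1 1) expnDn.
by apply: eq_bigr => k _; rewrite !exp1n !muln1.
Qed.

(** The bilinear sum on a pair of monomials. If a + b < p, each k satisfies p - k > a or k > b, so
    every term vanishes. *)
Lemma sum_derivn_Xn (R : numFieldType) (p a b : nat) : (a <= p)%N -> (b <= p)%N ->
  \sum_(k < p.+1) ('X^a)^`(p - k) * ('X^b)^`(k) =
  if (p <= a + b)%N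
  then ((a`! * b`!)%:R / (a + b - p)`!%:R) *: (2%:R *: 'X) ^+ (a + b - p)
  else 0 :> {poly R}.
Proof.
move=> le_ap le_bp.
have term k : (k <= p)%N -> ('X^a)^`(p - k) * ('X^b)^`(k) =
    (if (p <= a + b)%N then (a ^_ (p - k) * b ^_ k)%:R *: 'X^(a + b - p)
     else 0) :> {poly R}.
  move=> le_kp; rewrite !derivnXn mulrnAl mulrnAr -!mulrnA scaler_nat.
  have [le_kb|gt_kb] := leqP k b; last first.
    by rewrite (ffact_small gt_kb) mul0n muln0 !mulr0n if_same.
  have [le_pka|gt_pka] := leqP (p - k) a; last first.
    by rewrite (ffact_small gt_pka) mul0n muln0 !mulr0n if_same.
  have le_pab : (p <= a + b)%N by lia.
  rewrite le_pab mulnC -exprD; congr ('X^_ *+ _); lia.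
rewrite (eq_bigr _ (fun (k : 'I_p.+1) _ => term k (ltn_ord k))).
case: leqP => [le_pab|_]; last by rewrite big1.
rewrite -scaler_suml -natr_sum exprZn scalerA; congr (_ *: _).
apply: (@mulfI _ (a + b - p)`!%:R); first by rewrite pnatr_eq0 -lt0n fact_gt0.
rewrite -natrM sum_ffact // !natrM natrX.
by field; rewrite pnatr_eq0 -lt0n fact_gt0.
Qed.

Lemma pi_polyE (R : realType) (p : nat) (mu lambda : 'rV[R]_p) :
  pi_poly mu lambda =
  p`!%:R^-1 *: \sum_(k < p.+1) (shifts mu)^`(p - k) * (shifts lambda)^`(k).
Proof. exact: line_poly_semisym. Qed.

Lemma sigma_elsym (R : realType) (n k : nat) (x : 'rV[R]_n) :
  sigma k x = elsym (x 0) k.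
Proof. exact: mmap_mesym. Qed.

(** Reindexing of the pairs with i + j <= p by l = p - j - i; the condition has the form in which
    the monomial degrees p - j and p - i produce it. *)
Lemma big_ord_anti_diagonal (V : nmodType) (p : nat) (F : nat -> nat -> V) :
  \sum_(j < p.+1) \sum_(i < p.+1 | (p <= (p - j) + (p - i))%N) F j i =
  \sum_(l < p.+1) \sum_(i < (p - l).+1) F (p - l - i)%N i.
Proof.
under [RHS]eq_bigr => l _ do
  rewrite (big_ord_widen p.+1 (fun i => F (p - l - i)%N i)) ?ltnS ?leq_subr //.
rewrite (exchange_big_dep xpredT) //= [RHS](exchange_big_dep xpredT) //=.
apply: eq_bigr => i _.
have le_ip : (i <= p)%N by rewrite -ltnS.
(* For fixed [i], both sides run over j <= p - i, the right-hand one in reverse order. *)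
transitivity (\sum_(j < (p - i).+1) F j i).
  rewrite (big_ord_widen p.+1 (fun j => F j i)) ?ltnS ?leq_subr //.
  by apply: eq_bigl => j; have := ltn_ord j; lia.
rewrite (reindex_inj rev_ord_inj) /=.
rewrite [LHS](big_ord_widen p.+1 (fun l => F ((p - i).+1 - l.+1)%N i))
  ?ltnS ?leq_subr //.
apply: eq_big => [l|l _]; first by have := ltn_ord l; lia.
by congr (F _ i); lia.
Qed.

Lemma pi_poly_expansion (R : realType) (p : nat) (mu lambda : 'rV[R]_p) :
  pi_poly mu lambda =
    \sum_(l < p.+1)
      (\sum_(i < (p - l).+1)
         ((p - i)`! * (l + i)`!)%:R / (p`! * l`!)%:R *
           sigma (p - l - i) mu * sigma i lambda) *: (2%:R *: 'X) ^+ l.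
Proof.
(* [G j i] is the contribution of the monomials of degrees p - j in q_mu and p - i in q_lambda. *)
pose G j i : {poly R} := ((p - i)`! * (p - j)`!)%:R /
  (p`! * (p - j - i)`!)%:R * sigma j mu * sigma i lambda *:
  (2%:R *: 'X) ^+ (p - j - i).
transitivity (\sum_(j < p.+1) \sum_(i < p.+1 | (p <= (p - j) + (p - i))%N) G j i);
  last first.
  rewrite big_ord_anti_diagonal; apply: eq_bigr => l _; rewrite scaler_suml.
  apply: eq_bigr => i _; rewrite /G.
  have lt_i := ltn_ord i; have lt_l := ltn_ord l.
  have -> : (p - (p - l - i) = l + i)%N by lia.
  by rewrite addnK.
rewrite pi_polyE !shifts_elsym.
under eq_bigr => k _ do rewrite !linear_sum /= big_distrlr /=.
rewrite exchange_big scaler_sumr; apply: eq_bigr => j _ /=.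
rewrite exchange_big scaler_sumr [RHS]big_mkcond; apply: eq_bigr => i _ /=.
have le_jp : (j <= p)%N by rewrite -ltnS.
have le_ip : (i <= p)%N by rewrite -ltnS.
under eq_bigr => k _ do rewrite !derivnZ -scalerAl -scalerAr scalerA.
rewrite -scaler_sumr sum_derivn_Xn ?leq_subr //.
case: leqP => [le_p|_]; last by rewrite !scaler0.
have -> : (p - j + (p - i) - p = p - j - i)%N by lia.
rewrite /G !scalerA !sigma_elsym; congr (_ *: _); rewrite !natrM.
by field; rewrite !pnatr_eq0 -!lt0n !fact_gt0.
Qed.

(** * Reduction of s_{n,p} to s_{p,p} *)

Lemma shifts_of_splits (R : realType) (p : nat) (q : {poly R}) :
  q \is monic -> size q = p.+1 -> real_rooted q ->
  exists y : 'rV[R]_p, q = shifts y.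
Proof.
move=> mon_q sz_q /real_rooted_splits[s].
rewrite (monicP mon_q) scale1r => qE.
have sz_s : size s = p by apply: succn_inj; rewrite -sz_q qE size_prod_XsubC.
exists (\row_i - s`_i); rewrite /shifts qE (big_nth 0) sz_s big_mkord.
by apply: eq_bigr => i _; rewrite mxE polyCN.
Qed.

Lemma real_rooted_shifts (R : realType) (n : nat) (x : 'rV[R]_n) :
  real_rooted (shifts x).
Proof.
move=> z; rewrite shifts_XsubC map_prod_XsubC.
rewrite -(big_map (real_complex R) xpredT (fun b => 'X - b%:P)) root_prod_XsubC.
by move=> /mapP[a _ ->].
Qed.

(* s_{n,p}(x, l) = s_{p,p}(y, l), where the - y_i are the roots of the
   (n - p)-th derivative of the polynomial with roots - x_i. *)
Lemma line_poly_semisym_reduction (R : realType) (n p : nat) (x : 'rV[R]_n)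
    (l : 'rV[R]_p) : (p <= n)%N ->
  exists y : 'rV[R]_p,
    line_poly (semisym R n p) (row_mx x l) (const_mx 1) = pi_poly y l.
Proof.
(* The (n - p)-th derivative of q_x has leading coefficient n!/p!, so [c] makes it monic; the same
   factor exchanges 1/n! and 1/p!. *)
move=> le_pn; pose c : R := p`!%:R / n`!%:R.
have fact_neq0 m : m`!%:R != 0 :> R by rewrite pnatr_eq0 -lt0n fact_gt0.
have nz_c : c != 0 by rewrite mulf_neq0 ?invr_eq0.
have lt_np : (n - p < size (shifts x))%N by rewrite size_shifts ltnS leq_subr.
have sz_d : size (c *: (shifts x)^`(n - p)) = p.+1.
  by rewrite size_scale // size_derivn size_shifts subSn ?leq_subr // subKn.
have [|||y dE] := @shifts_of_splits R p (c *: (shifts x)^`(n - p)).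
- rewrite monicE /lead_coef sz_d coefZ coef_derivn subnK //.
  have := monicP (shifts_monic x); rewrite /lead_coef size_shifts /= => ->.
  have := ffact_fact (leq_subr p n); rewrite /c subKn // => <-.
  rewrite natrM; apply/eqP; field.
  by rewrite fact_neq0 pnatr_eq0 -lt0n ffact_gt0 leq_subr.
- by [].
- apply/real_rootedZ => //; apply: real_rooted_derivn => //.
  exact: real_rooted_shifts.
exists y; rewrite line_poly_semisym // pi_polyE -dE !scaler_sumr.
apply: eq_bigr => k _; have le_kp : (k <= p)%N by rewrite -ltnS.
rewrite derivnZ -[in RHS]scalerAl scalerA /c mulrA mulVf // mul1r.
(* Differentiating n - p and then p - k times amounts to n - k times. *)
by rewrite /derivn -iterD addnC addnBA // subnK.
Qed.

Theorem theorem4p8 (R : realType) (p : nat) (hp : (1 <= p)%N) :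
  (((forall n : nat, (p <= n)%N -> hyperbolic (const_mx 1) (semisym R n p)) <->
      hyperbolic (const_mx 1) (semisym R p p)) /\
   (hyperbolic (const_mx 1) (semisym R p p) <->
      (forall mu lambda : 'rV[R]_p, real_rooted (pi_poly mu lambda)))) /\
  (forall mu lambda : 'rV[R]_p,
     pi_poly mu lambda =
       \sum_(l < p.+1)
         (\sum_(i < (p - l).+1)
            ((p - i)`! * (l + i)`!)%:R / (p`! * l`!)%:R *
              sigma (p - l - i) mu * sigma i lambda) *: (2%:R *: 'X) ^+ l).
Proof.
(* Homogeneity and positivity always hold, so hyperbolicity comes down to real-rootedness, and any
   vector splits into an x and an l block. *)
have hypP n : (p <= n)%N ->
    (forall (x : 'rV[R]_n) (l : 'rV[R]_p),
      real_rooted (line_poly (semisym R n p) (row_mx x l) (const_mx 1))) ->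
    hyperbolic (const_mx 1) (semisym R n p).
  move=> le_pn rr; split; first by exists p; apply: semisym_homog.
    exact: semisym_pos.
  by move=> x; rewrite -[x]hsubmxK; apply: rr.
have bc : hyperbolic (const_mx 1) (semisym R p p) <->
    forall mu lambda : 'rV[R]_p, real_rooted (pi_poly mu lambda).
  by split=> [[_ _ rr] mu lambda | rr]; [exact: rr | exact: hypP].
split; last exact: pi_poly_expansion.
(* (b) implies (a) through (c), since each restriction of s_{n,p} to a line is some pi_p(y, l). *)
split=> //; split=> [hyp | /bc rr n le_pn]; first exact: hyp.
apply: hypP => // x l.
by have [y ->] := line_poly_semisym_reduction x l le_pn.
Qed.
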